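(* Let $M$ be a simple regular matroid and let $A$ be a $g\times n$ totally unimodular real matrix with columns $v_1,\dots,v_n$ whose column matroid is $M$. Let $\sigma_A = \mathbb{R}_{>0}\langle v_1v_1^T,\dots,v_nv_n^T\rangle$, an open cone in the space of $g\times g$ real symmetric matrices, and let $\mathrm{Stab}(\sigma_A) = \{X \in GL_g(\mathbb{Z}) : X^T\sigma_A X = \sigma_A\}$. Each $X \in \mathrm{Stab}(\sigma_A)$ permutes the rays of the closure $\overline{\sigma_A}$ via $Q \mapsto X^TQX$; let $H$ be the group of permutations of the rays of $\overline{\sigma_A}$ realized in this way by elements of $\mathrm{Stab}(\sigma_A)$. Then $H \cong \mathrm{Aut}(M)$.
   Context: A matroid is simple if it has no loops and no parallel elements. A matrix is totally unimodular if every square submatrix has determinant in $\{0,1,-1\}$; a matroid is regular if it is representable over $\mathbb{R}$ by a totally unimodular matrix. The rays of $\overline{\sigma_A}$ are the rays $\mathbb{R}_{\geq 0}v_iv_i^T$, one for each column. $\mathrm{Aut}(M)$ is the group of permutations of the ground set of $M$ preserving independent sets. *)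

(* Defs.v *)
From mathcomp Require Import all_boot all_order all_algebra all_fingroup finmap.
From mathcomp Require Import boolp classical_sets reals.

Set Implicit Arguments.
Unset Strict Implicit.
Unset Printing Implicit Defensive.

Import GroupScope Order.TTheory GRing.Theory Num.Theory.
Local Open Scope ring_scope.

Record matroid (E : finType) := Matroid {
  indep : {set {set E}};
  indep0 : finset.set0 \in indep;
  indepS : forall I J : {set E}, I \subset J -> J \in indep -> I \in indep;
  indep_aug : forall I J : {set E}, I \in indep -> J \in indep ->
    (#|I| < #|J|)%N -> exists2 e, e \in J :\: I & e |: I \in indep }.

Definition matroid_loop (E : finType) (M : matroid E) (e : E) : bool :=
  [set e]%SET \notin indep M.

Definition matroid_parallel (E : finType) (M : matroid E) (e f : E) : bool :=
  [&& e != f, ~~ matroid_loop M e, ~~ matroid_loop M f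
    & [set e; f]%SET \notin indep M].

Definition simple_matroid (E : finType) (M : matroid E) : Prop :=
  (forall e, ~~ matroid_loop M e) /\ (forall e f, ~~ matroid_parallel M e f).

Definition matroid_iso (E F : finType) (M : matroid E) (N : matroid F) : Prop :=
  exists2 f : E -> F, bijective f
    & forall S : {set E}, (f @: S \in indep N) = (S \in indep M).

Definition matroid_Aut (E : finType) (M : matroid E) : {set {perm E}} :=
  [set s : {perm E} | [forall S : {set E},
     (s @: S \in indep M) == (S \in indep M)]]%SET.

Lemma matroid_AutP (E : finType) (M : matroid E) (s : {perm E}) :
  reflect (forall S : {set E}, (s @: S \in indep M) = (S \in indep M))
          (s \in matroid_Aut M).
Proof. by rewrite finset.inE; apply: (iffP forallP) => h S; apply/eqP. Qed.

Fact matroid_Aut_group_set (E : finType) (M : matroid E) :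
  group_set (matroid_Aut M).
Proof.
apply/group_setP; split=> [|s t /matroid_AutP hs /matroid_AutP ht].
  apply/matroid_AutP => S.
  by rewrite (eq_imset (g := id) S (@perm1 E)) imset_id.
apply/matroid_AutP => S.
by rewrite (eq_imset (g := t \o s) S (permM s t)) imset_comp ht hs.
Qed.

Canonical matroid_Aut_group (E : finType) (M : matroid E) :=
  Group (matroid_Aut_group_set M).

(* [free] is applied to the indexed family of columns, not to the set of their
   values: two equal columns are dependent. *)
Definition columns_indep (K : fieldType) (g n : nat) (A : 'M[K]_(g, n)) :
    {set {set 'I_n}} :=
  [set S : {set 'I_n} | free [seq col i A | i <- enum S]]%SET.

Section ColumnMatroid.
Variables (K : fieldType) (g n : nat) (A : 'M[K]_(g, n)).

Lemma columns_indepE (S : {set 'I_n}) (s : seq 'I_n) :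
  perm_eq (enum S) s ->
  (S \in columns_indep A) = free [seq col i A | i <- s].
Proof. by move=> h; rewrite finset.inE (perm_free (perm_map _ h)). Qed.

Fact columns_indep0 : finset.set0 \in columns_indep A.
Proof. by rewrite finset.inE enum_set0 nil_free. Qed.

Fact columns_indepS (I J : {set 'I_n}) :
  I \subset J -> J \in columns_indep A -> I \in columns_indep A.
Proof.
move=> sIJ; rewrite (@columns_indepE J (enum I ++ enum (J :\: I))).
  by rewrite map_cat => /catl_free; rewrite finset.inE.
apply: uniq_perm; rewrite ?enum_uniq ?cat_uniq ?enum_uniq //= ?andbT.
  apply/hasPn => x; rewrite !mem_enum finset.inE.
  by case/andP.
move=> x; rewrite mem_cat !mem_enum finset.inE.
by have [/(fintype.subsetP sIJ)->|] := boolP (x \in I).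
Qed.

Fact columns_indep_aug (I J : {set 'I_n}) :
  I \in columns_indep A -> J \in columns_indep A -> (#|I| < #|J|)%N ->
  exists2 e, e \in J :\: I & e |: I \in columns_indep A.
Proof.
move=> fI fJ ltIJ; apply/exists_inP; apply: contraLR ltIJ => /exists_inPn h.
rewrite -leqNgt !cardE -!(size_map (fun i => col i A)).
move: (fI) (fJ); rewrite !finset.inE => /eqP <- /eqP <-; apply/dimvS/span_subvP.
move=> _ /mapP[j jJ ->]; rewrite mem_enum in jJ.
have [jI|jI] := boolP (j \in I).
  by apply/memv_span/map_f; rewrite mem_enum.
have := h j; rewrite finset.inE jI jJ => /(_ isT); apply: contraNT => nj.
rewrite (@columns_indepE _ (j :: enum I)); last first.
  apply: uniq_perm; rewrite /= ?enum_uniq ?mem_enum ?jI //.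
  by move=> x; rewrite in_cons !mem_enum !finset.inE.
by rewrite /= free_cons nj; move: fI; rewrite finset.inE.
Qed.

Definition column_matroid : matroid 'I_n :=
  Matroid columns_indep0 columns_indepS columns_indep_aug.

End ColumnMatroid.

(* Strictly increasing index maps select exactly the ordinary submatrices. *)
Definition totally_unimodular (R : realType) (g n : nat) (A : 'M[R]_(g, n)) :
    Prop :=
  forall (k : nat) (r : 'I_k -> 'I_g) (c : 'I_k -> 'I_n),
    {homo r : i j / (i < j)%N} -> {homo c : i j / (i < j)%N} ->
    \det (mxsub r c A) \in [:: 0; 1; -1].

Definition regular_matroid (R : realType) (E : finType) (M : matroid E) : Prop :=
  exists (g n : nat) (B : 'M[R]_(g, n)),
    totally_unimodular B /\ matroid_iso (column_matroid B) M.

Section Cone.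
Variables (R : realType) (g n : nat) (A : 'M[R]_(g, n)).

Definition rank_one (i : 'I_n) : 'M[R]_g := col i A *m (col i A)^T.

Definition cone : set 'M[R]_g :=
  [set Q | exists2 c : 'I_n -> R, forall i, 0 < c i
         & Q = \sum_i c i *: rank_one i]%classic.

Definition congr_act (X : 'M[int]_g) (Q : 'M[R]_g) : 'M[R]_g :=
  (map_mx intr X)^T *m Q *m map_mx intr X.

Definition cone_Stab : set 'M[int]_g :=
  [set X | X \in unitmx /\ (congr_act X @` cone = cone)%classic]%classic.

Definition ray (i : 'I_n) : set 'M[R]_g :=
  [set Q | exists2 t : R, 0 <= t & Q = t *: rank_one i]%classic.

(* The rays of the closure of [cone]; the collapsing of repeated rays plays no
   role when the columns are nonzero and pairwise non-parallel. *)
Definition rays : {fset set 'M[R]_g} := [fset ray i | i in 'I_n]%fset.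

Definition ray_perms : {set {perm rays}} :=
  [set s : {perm rays} | `[< exists2 X, cone_Stab X
     & forall r : rays, val (s r) = (congr_act X @` val r)%classic >]]%SET.

Lemma ray_permsP (s : {perm rays}) :
  reflect (exists2 X, cone_Stab X
     & forall r : rays, val (s r) = (congr_act X @` val r)%classic)
   (s \in ray_perms).
Proof. by rewrite finset.inE; apply: asboolP. Qed.

Lemma congr_act1 : congr_act 1%:M = id.
Proof.
by apply/funext=> Q; rewrite /congr_act map_mx1 trmx1 mul1mx mulmx1.
Qed.

Lemma congr_actM (X Y : 'M[int]_g) :
  congr_act (X *m Y) = congr_act Y \o congr_act X.
Proof.
by apply/funext=> Q; rewrite /congr_act /= map_mxM trmx_mul !mulmxA.
Qed.

Fact ray_perms_group_set : group_set ray_perms.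
Proof.
apply/group_setP; split.
  apply/ray_permsP; exists 1%:M; first by split; rewrite ?unitmx1 // congr_act1 image_id.
  by move=> r; rewrite perm1 congr_act1 image_id.
move=> s t /ray_permsP[X [uX sX] hX] /ray_permsP[Y [uY sY] hY].
apply/ray_permsP; exists (X *m Y).
  by split; rewrite ?unitmx_mul ?uX // congr_actM -image_comp sX sY.
by move=> r; rewrite permM hY hX congr_actM -image_comp.
Qed.

Canonical ray_perms_group := Group ray_perms_group_set.

End Cone.

(* Main.v *)
Require Import Defs.
From mathcomp Require Import all_boot all_order all_algebra all_fingroup finmap.
From mathcomp Require Import boolp classical_sets reals.
From mathcomp Require Import ring lra zify.

(* An [X] stabilizing the cone and permuting the rays by [s] satisfies
   [X^T v_i = c_i v_(s i)] with [c_i <> 0], so [s] is an automorphism of the column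
   matroid.  Conversely, for an automorphism [s] the matrices [A] and [A'] (the
   columns of [A] permuted by [s]) are totally unimodular with the same matroid, and
   it suffices to find [F] in GL_g(Z) and signs [e] with [F A = A' diag e]; then
   [X = F^T].
   Complete the columns of a common basis to unimodular matrices [P] and [P'] by unit
   vectors.  The tableaux [C = P^-1 A] and [C' = P'^-1 A'] have the same support,
   since their nonzero entries are the basis exchanges.  Along a chordless cycle of
   length [2m] in the bipartite graph of this support, the product of the entries of
   such a tableau is [(-1)^m], because the corresponding minor is even, hence zero.
   So the signs [C_ij C'_ij] have product 1 on chordless cycles, hence on all
   cycles, and are of the form [d_i e_j] (Camion).  Then
   [F = P' diag(d) P^-1]. *)

Set Implicit Arguments.
Unset Strict Implicit.
Unset Printing Implicit Defensive.
Import Order.TTheory GRing.Theory Num.Theory.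
Local Open Scope ring_scope.

(** * Balanced signs on a bipartite graph *)

Section SignPotential.
Variables (F : numDomainType) (I J : finType) (w : I -> J -> F).
Hypothesis w_sign : forall i j, w i j != 0 -> w i j ^+ 2 = 1.

(* A walk on the row vertices: the pair [(j, i')] is the step through the
   column [j] to the row [i']. *)
Definition walk_end (i : I) (p : seq (J * I)) : I := last i (map snd p).

Fixpoint is_walk (i : I) (p : seq (J * I)) : bool :=
  if p is (j, k) :: q then [&& w i j != 0, w k j != 0 & is_walk k q] else true.

Fixpoint walk_sign (i : I) (p : seq (J * I)) : F :=
  if p is (j, k) :: q then w i j * w k j * walk_sign k q else 1.

Lemma walk_end_cat i p q : walk_end i (p ++ q) = walk_end (walk_end i p) q.
Proof. by rewrite /walk_end map_cat last_cat. Qed.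

Lemma is_walk_cat i p q :
  is_walk i (p ++ q) = is_walk i p && is_walk (walk_end i p) q.
Proof. by elim: p i => //= -[j k] p IH i; rewrite IH -!andbA. Qed.

Lemma walk_sign_cat i p q :
  walk_sign i (p ++ q) = walk_sign i p * walk_sign (walk_end i p) q.
Proof. by elim: p i => [|[j k] p IH] i /=; rewrite ?mul1r // IH mulrA. Qed.

Lemma walk_sign_sqr i p : is_walk i p -> walk_sign i p ^+ 2 = 1.
Proof.
elim: p i => [|[j k] p IH] i /=; first by rewrite expr1n.
by case/and3P=> hi hk hp; rewrite !exprMn !w_sign // IH // !mul1r.
Qed.

Lemma walk_rev i p : is_walk i p ->
  exists q, [/\ is_walk (walk_end i p) q, walk_end (walk_end i p) q = i
    & walk_sign (walk_end i p) q = walk_sign i p].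
Proof.
elim: p i => [|[j k] p IH] i /=; first by exists [::].
case/and3P=> hi hk /IH[q [wq eq sq]]; exists (q ++ [:: (j, i)]).
have -> : walk_end i ((j, k) :: p) = walk_end k p by [].
rewrite is_walk_cat walk_end_cat walk_sign_cat eq sq wq /= hi hk.
by split=> //; ring.
Qed.

Definition unbalanced i p :=
  [&& is_walk i p, walk_end i p == i & walk_sign i p != 1].

Lemma unbalanced_split i p q r : unbalanced i (p ++ q ++ r) ->
  walk_end (walk_end i p) q = walk_end i p ->
  unbalanced (walk_end i p) q || unbalanced i (p ++ r).
Proof.
rewrite /unbalanced !is_walk_cat !walk_end_cat !walk_sign_cat => /and3P[].
case/and3P=> wp wq wr er sr eq; rewrite eq in wr er sr *.
rewrite wp wq wr er eqxx /= -negb_and; apply: contra sr => /andP[/eqP hq /eqP h].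
by rewrite mulrCA h hq mulr1.
Qed.

(** The chord joins the row [walk_end i p] to the later column [j]. Each of the two closed walks
    uses it once, so the product of their signs is the original sign times the square of the chord,
    which is 1. *)
Lemma unbalanced_chord i p q j k r :
    unbalanced i (p ++ q ++ (j, k) :: r) -> w (walk_end i p) j != 0 ->
  unbalanced (walk_end i p) (rcons q (j, walk_end i p)) ||
  unbalanced i (p ++ (j, k) :: r).
Proof.
rewrite /unbalanced -cats1 !is_walk_cat !walk_end_cat !walk_sign_cat /=.
set x := walk_end i p; set y := walk_end x q.
case/and3P=> /and4P[wp wq wy /andP[wk wr]] er sr wx.
rewrite wp wq wy wx wk wr /= /walk_end /= eqxx er /= -negb_and.
apply: contra sr => /andP[/eqP h1 /eqP h2]; apply/eqP.
have := w_sign wx; rewrite expr2 => hx.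
by have := congr2 *%R h1 h2; rewrite (mulr1 1) => <-; rewrite -[LHS]mulr1 -[in LHS]hx; ring.
Qed.

(** The same cut for a chord from the column [j] to a later row. *)
Lemma unbalanced_cochord i p j k q r :
    unbalanced i (p ++ (j, k) :: q ++ r) -> w (walk_end k q) j != 0 ->
  unbalanced (walk_end k q) ((j, k) :: q) ||
  unbalanced i (p ++ (j, walk_end k q) :: r).
Proof.
rewrite /unbalanced !is_walk_cat !walk_end_cat !walk_sign_cat /=.
set x := walk_end i p.
rewrite !is_walk_cat !walk_sign_cat.
have -> : walk_end x ((j, k) :: q ++ r) = walk_end (walk_end k q) r.
  by rewrite -walk_end_cat.
rewrite /(walk_end _ ((j, k) :: q)) /= -/(walk_end k q).
rewrite /(walk_end x ((j, _) :: r)) /= -/(walk_end (walk_end k q) r).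
set y := walk_end k q.
case/and3P=> /and5P[wp wx wk wq wr] er sr wy.
rewrite wp wq wy wx wk wr er eqxx /= -negb_and.
apply: contra sr => /andP[/eqP h1 /eqP h2]; apply/eqP.
have := w_sign wy; rewrite expr2 => hy.
by have := congr2 *%R h1 h2; rewrite (mulr1 1) => <-; rewrite -[LHS]mulr1 -[in LHS]hy; ring.
Qed.


(** * Shortest unbalanced closed walks *)

Section Indexing.
Variables (i : I) (j0 : J).

(** Column [a] of the walk lies between rows [a] and [a.+1]. Row 0 is the start, and on a closed
    walk row [size p] is the start again. *)
Definition walk_row (p : seq (J * I)) (a : nat) : I := walk_end i (take a p).
Definition walk_col (p : seq (J * I)) (a : nat) : J := (nth (j0, i) p a).1.

Lemma walk_row0 p : walk_row p 0 = i.
Proof. by rewrite /walk_row take0. Qed.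

Lemma walk_drop p a : (a < size p)%N ->
  drop a p = (walk_col p a, walk_row p a.+1) :: drop a.+1 p.
Proof.
move=> lt_a; rewrite (drop_nth (j0, i)) // /walk_row (take_nth (j0, i)) //.
by rewrite -cats1 walk_end_cat /walk_col /walk_end /=; case: nth.
Qed.

Lemma walk_split p a : (a < size p)%N ->
  p = take a p ++ (walk_col p a, walk_row p a.+1) :: drop a.+1 p.
Proof. by move=> lt_a; rewrite -walk_drop // cat_take_drop. Qed.

Lemma walk_edges p a : is_walk i p -> (a < size p)%N ->
  w (walk_row p a) (walk_col p a) != 0 /\ w (walk_row p a.+1) (walk_col p a) != 0.
Proof.
move=> wp lt_a; move: wp; rewrite {1}(walk_split lt_a) is_walk_cat /=.
by case/andP=> _ /and3P[].
Qed.

Lemma walk_row_segment p a b : (a <= b)%N ->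
  walk_end (walk_row p a) (take (b - a) (drop a p)) = walk_row p b.
Proof. by move=> le_ab; rewrite -walk_end_cat -takeD subnKC. Qed.

Lemma walk_sign_prod p : walk_sign i p =
  \prod_(a < size p) (w (walk_row p a) (walk_col p a) *
                      w (walk_row p a.+1) (walk_col p a)).
Proof.
suff H n : (n <= size p)%N -> walk_sign i (take n p) =
  \prod_(a < n) (w (walk_row p a) (walk_col p a) *
                      w (walk_row p a.+1) (walk_col p a)).
  by rewrite -H // take_size.
elim: n => [|n IH] lt_n; first by rewrite take0 big_ord0.
rewrite big_ord_recr -IH ?(ltnW lt_n) //= (take_nth (j0, i)) // -cats1.
rewrite walk_sign_cat /= /walk_row (take_nth (j0, i)) // -cats1 walk_end_cat.
by rewrite /walk_col; case: nth => j k /=; rewrite mulr1.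
Qed.

Variable p : seq (J * I).
Hypothesis p_unbal : unbalanced i p.
Hypothesis p_min : forall k q, (size q < size p)%N -> ~~ unbalanced k q.

(* Cutting a closed walk along a repeated row or along a chord gives two closed
   walks whose signs multiply to the original one, so a shortest unbalanced walk
   has neither. *)
Lemma min_row_inj a b : (a < b)%N -> (b < size p)%N ->
  walk_row p a != walk_row p b.
Proof.
move=> lt_ab lt_b; apply/eqP => eq_ab.
have pE : p = take a p ++ take (b - a) (drop a p) ++ drop b p.
  by rewrite catA -takeD subnKC ?cat_take_drop // ltnW.
have := p_unbal; rewrite [X in unbalanced i X]pE => /unbalanced_split.
rewrite walk_row_segment ?(ltnW lt_ab) // => /(_ (esym eq_ab)) /orP[] /idPn[];
  by apply: p_min; rewrite ?size_cat size_takel ?size_drop; lia.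
Qed.

(** The two cut walks have lengths [b - a + 1] and [size p - (b - a)]. Only the first can fail to be
    shorter than [p], namely when the edge is the one by which the closed walk returns to its
    start. *)
Lemma min_chord a b : (a < b)%N -> (b < size p)%N ->
  w (walk_row p a) (walk_col p b) != 0 -> a = 0%N /\ b.+1 = size p.
Proof.
move=> lt_ab lt_b wab.
have pE : p = take a p ++ take (b - a) (drop a p) ++
              (walk_col p b, walk_row p b.+1) :: drop b.+1 p.
  by rewrite -walk_drop // catA -takeD subnKC ?cat_take_drop // ltnW.
have sq : size (take (b - a) (drop a p)) = (b - a)%N.
  by rewrite size_takel // size_drop; lia.
have := p_unbal; rewrite [X in unbalanced i X]pE => /unbalanced_chord/(_ wab).
case: (boolP ((a == 0%N) && (b.+1 == size p))) => [/andP[/eqP-> /eqP->] //|ne].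
case/orP=> /idPn[]; apply: p_min.
  by rewrite size_rcons sq; lia.
by rewrite size_cat /= size_takel ?size_drop; lia.
Qed.

Lemma min_cochord a b : (b.+1 < a)%N -> (a < size p)%N ->
  w (walk_row p a) (walk_col p b) = 0.
Proof.
move=> lt_ba lt_a; apply/eqP; apply: contraT => wab.
have lt_b : (b < size p)%N by lia.
set q := take (a - b.+1) (drop b.+1 p).
have qE : walk_end (walk_row p b.+1) q = walk_row p a.
  by rewrite walk_row_segment // ltnW.
have pE : p = take b p ++ (walk_col p b, walk_row p b.+1) :: q ++ drop a p.
  have -> : q ++ drop a p = drop b.+1 p.
    rewrite -[RHS](cat_take_drop (a - b.+1)) drop_drop subnK //; exact: ltnW.
  exact: walk_split.
have sq : size q = (a - b.+1)%N by rewrite size_takel // size_drop; lia.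
rewrite -qE in wab.
have := p_unbal; rewrite [X in unbalanced i X]pE => /unbalanced_cochord/(_ wab).
case/orP=> /idPn[]; apply: p_min.
  by rewrite /= sq; lia.
by rewrite size_cat /= size_takel ?size_drop; lia.
Qed.

End Indexing.

(* The cycle runs through [r a], [c a], [r (ordS a)], so that the cell
   [(r a, c b)] lies on it exactly when [a = b] or [a = ordS b]. *)
Definition chordless m (r : 'I_m -> I) (c : 'I_m -> J) :=
  [/\ injective r, forall a, w (r a) (c a) != 0,
      forall a, w (r (ordS a)) (c a) != 0
    & forall a b, w (r a) (c b) != 0 -> a = b \/ a = ordS b].

Hypothesis chordless_balanced : forall m (r : 'I_m -> I) (c : 'I_m -> J),
  (1 < m)%N -> chordless r c ->
  \prod_a (w (r a) (c a) * w (r (ordS a)) (c a)) = 1.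

(** By induction on the length: a shortest unbalanced walk traces a chordless cycle with at least
    two rows, which contradicts [chordless_balanced]. *)
Lemma closed_walk_balanced i p : ~~ unbalanced i p.
Proof.
move: {2}_.+1 (ltnSn (size p)) => n; elim: n i p => // n IHn i p lt_pn.
apply/negP => p_unbal.
have p_min k q : (size q < size p)%N -> ~~ unbalanced k q.
  by move=> lt_qp; apply: IHn; lia.
have /and3P[wp /eqP ep /eqP] := p_unbal; apply.
(* A closed walk of one step runs along an edge and back, so its sign is a square. *)
have [|p_big] := leqP (size p) 1.
  case: p wp ep {lt_pn p_unbal p_min} => [|[j k] []] //= /and3P[wi wk _] <- _.
  by rewrite /walk_end /= mulr1 -expr2 w_sign.
have [j0 _] : exists j0 : J, true by case: (p) p_big => [|[j k] q] // _; exists j.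
pose r (a : 'I_(size p)) := walk_row i p a.
pose c (a : 'I_(size p)) := walk_col i j0 p a.
(* At the last index [ordS] wraps around to 0, in accordance with the walk being closed. *)
have rS a : r (ordS a) = walk_row i p a.+1.
  rewrite /r /=; have := ltn_ord a; rewrite leq_eqVlt => /predU1P[->|lt_a].
    by rewrite modnn walk_row0 /walk_row take_size.
  by rewrite modn_small.
have chord : chordless r c.
  split=> [a b rab|a|a|a b wab].
  - apply/val_inj; case: (ltngtP a b) => // lt_ab.
      by have := min_row_inj p_unbal p_min lt_ab (ltn_ord b); rewrite -/(r a) rab eqxx.
    by have := min_row_inj p_unbal p_min lt_ab (ltn_ord a); rewrite -/(r a) rab eqxx.
  - by case: (walk_edges j0 wp (ltn_ord a)).
  - by rewrite rS; case: (walk_edges j0 wp (ltn_ord a)).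
  case: (ltngtP a b) => [lt_ab|lt_ba|/val_inj]; last by left.
    right; have [a0 bE] := min_chord p_unbal p_min lt_ab (ltn_ord b) wab.
    by apply/val_inj; rewrite /= bE modnn.
  right; apply/val_inj; rewrite /= modn_small; last by have := ltn_ord a; lia.
  have [lt_ba'|] := ltnP b.+1 a; last by lia.
  by rewrite (min_cochord j0 p_unbal p_min lt_ba' (ltn_ord a)) eqxx in wab.
have := chordless_balanced p_big chord.
under eq_bigr do rewrite rS.
by rewrite -walk_sign_prod.
Qed.

Definition row_link : rel I := [rel i k | [exists j, (w i j != 0) && (w k j != 0)]].

Lemma connect_walk i k : connect row_link i k ->
  exists2 p, is_walk i p & walk_end i p = k.
Proof.
case/connectP=> s; elim: s i => [|l s IH] i /=; first by move=> _ ->; exists [::].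
case/andP=> /existsP[j /andP[wi wl]] /IH h /h[p wp ep].
by exists ((j, l) :: p) => //=; rewrite wi wl.
Qed.

Lemma row_link_sym : connect_sym row_link.
Proof.
by apply: sym_connect_sym => i k; apply: eq_existsb => j; rewrite andbC.
Qed.

(** Let [d i] be the sign of some walk to [i] from the root of its component. For rows [i] and [k]
    adjacent to [j], the two walks joined through [j] form a closed walk. Its balance makes
    [d i * w i j] independent of the row, and this common value is [e j]. *)
Theorem sign_potential : exists (d : I -> F) (e : J -> F),
  [/\ forall i, d i ^+ 2 = 1, forall j, e j ^+ 2 = 1
    & forall i j, w i j != 0 -> w i j = d i * e j].
Proof.
have exd i : exists x : F, exists p, [/\ is_walk (fingraph.root row_link i) p,
    walk_end (fingraph.root row_link i) p = i & x = walk_sign (fingraph.root row_link i) p].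
  have /connect_walk[p wp ep] : connect row_link (fingraph.root row_link i) i.
    by rewrite row_link_sym connect_root.
  by exists (walk_sign (fingraph.root row_link i) p), p.
have [d dP] := fin_all_exists exd.
have d2 i : d i ^+ 2 = 1 by have [p [wp _ ->]] := dP i; rewrite walk_sign_sqr.
have step i k j : w i j != 0 -> w k j != 0 -> d i * w i j = d k * w k j.
  move=> wi wk; have [p [wp ep dp]] := dP i; have [q [wq eq dq]] := dP k.
  have eqr : fingraph.root row_link i = fingraph.root row_link k.
    apply/(fingraph.rootP row_link_sym)/connect1/existsP; exists j; by rewrite wi wk.
  have [q' []] := walk_rev wq; rewrite eq => wq' eq' sq'.
  have := closed_walk_balanced (fingraph.root row_link i) (p ++ (j, k) :: q').
  rewrite /unbalanced is_walk_cat walk_end_cat walk_sign_cat wp /= ep wi wk wq' /=.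
  have -> : walk_end i ((j, k) :: q') = walk_end k q' by [].
  rewrite eq' eqr eqxx /= negbK sq' -dq -eqr -dp => /eqP h.
  have := d2 k; have := w_sign wk; rewrite !expr2 => h1 h2.
  transitivity (d i * (w i j * w k j * d k) * (w k j * d k)); last by rewrite h; ring.
  rewrite -[LHS]mulr1 -[in LHS]h2 -[LHS]mulr1 -[in LHS]h1; ring.
(* An isolated column still needs a value of square 1. *)
pose e j := if [pick i | w i j != 0] is Some i then d i * w i j else 1.
exists d, e; split=> // [j|i j wij]; rewrite /e; case: pickP => [k wk|none].
- by rewrite exprMn d2 w_sign // mulr1.
- by rewrite expr1n.
- by rewrite -(step i k j wij wk) mulrA -expr2 d2 mul1r.
- by have := none i; rewrite wij.
Qed.

End SignPotential.

(** * Total unimodularity *)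

Section Unimodular.
Variable R : realType.
Implicit Types x y : R.

Notation signs := [:: 0; 1; -1 : R].

Lemma signsM x y : x \in signs -> y \in signs -> x * y \in signs.
Proof.
by rewrite !inE => /or3P[]/eqP-> /or3P[]/eqP->;
   rewrite ?(mul0r, mulr0, mul1r, mulr1, mulrNN) eqxx ?orbT.
Qed.

Lemma sqr_signs x : x \in signs -> x != 0 -> x ^+ 2 = 1.
Proof. by rewrite !inE => /or3P[]/eqP->; rewrite ?eqxx ?sqrrN ?expr1n. Qed.

Lemma signs_int x : x \in signs -> x \is a Num.int.
Proof. by rewrite !inE => /or3P[]/eqP->; rewrite ?rpredN ?rpred0 ?rpred1. Qed.

Lemma exp_sign_signs k : (-1) ^+ k \in signs.
Proof. by rewrite -signr_odd; case: odd; rewrite !inE eqxx ?orbT. Qed.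

(** Sending [i] to the number of values of [r] below [r i] is a permutation; its inverse sorts
    [r]. *)
Lemma sorting_perm k n (r : 'I_k -> 'I_n) : injective r ->
  exists s : 'S_k, {homo r \o s : i j / (i < j)%N}.
Proof.
move=> r_inj; pose q i := #|[set j | (r j < r i)%N]%SET|.
have q_lt i : (q i < k)%N.
  rewrite -[X in (_ < X)%N]card_ord; apply: proper_card; rewrite fintype.properE.
  apply/andP; split; first exact/fintype.subsetP.
  by apply/fintype.subsetPn; exists i; rewrite // finset.inE ltnn.
have q_mono i j : (r i < r j)%N -> (q i < q j)%N.
  move=> lt_ij; apply: proper_card; apply/fintype.properP; split.
    by apply/fintype.subsetP => l; rewrite !finset.inE => /ltn_trans->.
  by exists i; rewrite !finset.inE ?ltnn.
have q_inj : injective (fun i => Ordinal (q_lt i)).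
  move=> i j [qij]; apply/r_inj/val_inj; case: (ltngtP (r i) (r j)) => // /q_mono.
    by rewrite qij ltnn.
  by rewrite qij ltnn.
exists (perm q_inj)^-1%g => i j lt_ij /=.
rewrite ltnNge leq_eqVlt; apply/negP => /predU1P[/val_inj/r_inj/perm_inj eji|].
  by rewrite eji ltnn in lt_ij.
move/q_mono.
have qV l : q ((perm q_inj)^-1%g l) = l.
  by rewrite -[in RHS](permKV (perm q_inj) l) permE.
by rewrite !qV ltnNge ltnW.
Qed.

Lemma det_row_noninj k g n (A : 'M[R]_(g, n)) (r : 'I_k -> 'I_g) (c : 'I_k -> 'I_n) :
  ~ injective r -> \det (mxsub r c A) = 0.
Proof.
move=> /existsNP[i /existsNP[j /not_implyP[rij /eqP nij]]].
by apply: (determinant_alternate nij) => l; rewrite !mxE rij.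
Qed.

Lemma det_col_noninj k g n (A : 'M[R]_(g, n)) (r : 'I_k -> 'I_g) (c : 'I_k -> 'I_n) :
  ~ injective c -> \det (mxsub r c A) = 0.
Proof. by move=> c_ninj; rewrite -det_tr trmx_mxsub det_row_noninj. Qed.

(** This frees the minors from monotone index maps: a repeated index gives determinant 0, and
    sorting injective maps only changes the sign. *)
Lemma tu_minor g n (A : 'M[R]_(g, n)) k (r : 'I_k -> 'I_g) (c : 'I_k -> 'I_n) :
  totally_unimodular A -> \det (mxsub r c A) \in signs.
Proof.
move=> tuA; have [r_inj|r_ninj] := pselect (injective r); last first.
  by rewrite det_row_noninj // inE eqxx.
have [c_inj|c_ninj] := pselect (injective c); last first.
  by rewrite det_col_noninj // inE eqxx.
have [s s_mono] := sorting_perm r_inj; have [t t_mono] := sorting_perm c_inj.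
have := tuA _ _ _ s_mono t_mono.
have -> : mxsub (r \o s) (c \o t) A = row_perm s (col_perm t (mxsub r c A)).
  by apply/matrixP => i j; rewrite !mxE.
rewrite row_permE col_permE !det_mulmx !det_perm => h.
set d := \det _ in h *.
have -> : d = (-1) ^+ s * ((-1) ^+ s * (d * (-1) ^+ (t^-1)%g)) * (-1) ^+ (t^-1)%g.
  by rewrite mulrA -expr2 sqrr_sign mul1r -mulrA -expr2 sqrr_sign mulr1.
by apply: signsM; rewrite ?exp_sign_signs // signsM ?exp_sign_signs.
Qed.

(** Only minors using all rows are constrained, so the property survives a change of basis of
    determinant 1 or -1. An adjoined identity block gives access to the smaller minors. *)
Definition unimodular g m (U : 'M[R]_(g, m)) : Prop :=
  forall f : 'I_g -> 'I_m, \det (colsub f U) \in signs.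

(** Induction on the size: expanding along a column of the identity block leaves at most one term, a
    smaller minor up to sign. Without such a column the minor is one of [A]. *)
Lemma tu_minor_row_id g n (A : 'M[R]_(g, n)) k
    (r : 'I_k -> 'I_g) (c : 'I_k -> 'I_(n + g)) :
  totally_unimodular A -> \det (mxsub r c (row_mx A 1%:M)) \in signs.
Proof.
move=> tuA; elim: k r c => [|k IH] r c; first by rewrite det_mx00 !inE eqxx orbT.
have [r_inj|r_ninj] := pselect (injective r); last first.
  by rewrite det_row_noninj // inE eqxx.
have [/existsP[j /existsP[l /eqP cj]]|/existsPn cl] :=
    boolP [exists j, [exists l, c j == rshift n l]]; last first.
  have [c' cE] : exists c', forall j, c j = lshift g (c' j).
    suff h j : exists i, c j = lshift g i by have [c' c'E] := boolp.choice h; exists c'.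
    case: (splitP (c j)) => i ci.
      by exists i; apply: val_inj.
    by have /existsPn/(_ i)/eqP[] := cl j; apply: val_inj.
  rewrite (_ : mxsub _ _ _ = mxsub r c' A) ?tu_minor //.
  by apply/matrixP => i j; rewrite [LHS]mxE cE row_mxEl mxE.
rewrite (expand_det_col _ j).
have entry i : mxsub r c (row_mx A 1%:M) i j = (r i == l)%:R.
  by rewrite mxE cj row_mxEr mxE.
have cof i : cofactor (mxsub r c (row_mx A 1%:M)) i j \in signs.
  rewrite /cofactor signsM ?exp_sign_signs //.
  rewrite (_ : row' _ _ = mxsub (r \o lift i) (c \o lift j) (row_mx A 1%:M)) //.
  by apply/matrixP => a b; rewrite !mxE.
have [/existsP[i /eqP ri]|/existsPn rl] := boolP [exists i, r i == l]; last first.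
  by rewrite big1 ?inE ?eqxx // => i _; rewrite entry (negPf (rl i)) mul0r.
rewrite (bigD1 i) //= big1 ?addr0 ?entry ?ri ?eqxx ?mul1r // => i' ne_i.
by rewrite entry -ri (inj_eq r_inj) (negPf ne_i) mul0r.
Qed.

Lemma tu_unimodular g n (A : 'M[R]_(g, n)) :
  totally_unimodular A -> unimodular (row_mx A 1%:M).
Proof.
move=> tuA f; exact: tu_minor_row_id.
Qed.


Lemma det_int g (M : 'M[R]_g) :
  (forall i j, M i j \is a Num.int) -> \det M \is a Num.int.
Proof.
move=> M_int; apply: rpred_sum => s _; rewrite rpredM ?rpred_prod //.
by rewrite rpredX // rpredN rpred1.
Qed.

Lemma adj_int g (M : 'M[R]_g) i j :
  (forall i j, M i j \is a Num.int) -> (\adj M) i j \is a Num.int.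
Proof.
move=> M_int; rewrite mxE rpredM ?rpredX ?rpredN ?rpred1 //.
by apply: det_int => a b; rewrite !mxE.
Qed.

Definition subst_at (T : eqType) S (f : T -> S) (i : T) (s : S) : T -> S :=
  fun k => if k == i then s else f k.

(** Row [i] of this matrix vanishes off the diagonal, and deleting row and column [i] leaves an
    identity matrix. Thus the entries of a tableau are the determinants of single exchanges. *)
Lemma det_subst_id g n (C : 'M[R]_(g, n)) i j :
  \det (colsub (subst_at (@rshift n g) i (lshift g j)) (row_mx C 1%:M)) = C i j.
Proof.
set Q := colsub _ _; have QE a k : Q a k = if k == i then C a j else (a == k)%:R.
  by rewrite /Q mxE /subst_at; case: eqP; rewrite ?row_mxEl // row_mxEr mxE.
rewrite (expand_det_row _ i) (bigD1 i) //= big1 => [|k ki]; last first.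
  by rewrite QE (negPf ki) eq_sym (negPf ki) mul0r.
rewrite addr0 QE eqxx /cofactor -signr_odd oddD addbb mul1r.
rewrite (_ : row' _ _ = 1%:M) ?det1 ?mulr1 //.
apply/matrixP => a b; rewrite 2!mxE QE !mxE eq_sym (negPf (neq_lift _ _)).
by rewrite (inj_eq lift_inj).
Qed.

Lemma unimodular_entry g n (C : 'M[R]_(g, n)) i j :
  unimodular (row_mx C 1%:M) -> C i j \in signs.
Proof. by move=> uC; rewrite -det_subst_id. Qed.

Lemma ordS_neq m (a : 'I_m) : (1 < m)%N -> ordS a != a.
Proof.
move=> m_gt1; apply/eqP => /(congr1 val) /=; have := ltn_ord a.
rewrite leq_eqVlt => /predU1P[aE|lt_a]; last by rewrite modn_small //; lia.
by rewrite aE modnn; lia.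
Qed.

Lemma ordS_invariant m T (h : 'I_m -> T) :
  (forall a, h (ordS a) = h a) -> forall a b, h a = h b.
Proof.
move=> hS; suff H k (lt_k : (k < m)%N) (lt_0 : (0 < m)%N) :
    h (Ordinal lt_k) = h (Ordinal lt_0).
  move=> [a lt_a] [b lt_b]; have lt_0 : (0 < m)%N by lia.
  by rewrite !(H _ _ lt_0).
elim: k lt_k => [|k IH] lt_k; first by congr h; apply: val_inj.
rewrite -(IH (ltnW lt_k)) -[RHS]hS; congr h; apply: val_inj => /=.
by rewrite modn_small.
Qed.

(** * Chordless cycles in a unimodular tableau *)

Section ChordlessProduct.
Variables (g n m : nat) (C : 'M[R]_(g, n)) (r : 'I_m -> 'I_g) (c : 'I_m -> 'I_n).
Hypotheses (uC : unimodular (row_mx C 1%:M)) (m_gt1 : (1 < m)%N).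
Hypothesis rc : chordless C r c.

Let rc_inj : injective r. Proof. by case: rc. Qed.

Lemma chordless_row (v : 'I_m -> R) b :
  \sum_a C (r (ordS b)) (c a) * v a =
  C (r (ordS b)) (c (ordS b)) * v (ordS b) + C (r (ordS b)) (c b) * v b.
Proof.
case: rc => _ _ _ ch; rewrite (bigD1 (ordS b)) //= (bigD1 b) /=; last first.
  by rewrite eq_sym ordS_neq.
rewrite big1 ?addr0 // => a /andP[ne_S ne_b].
apply/eqP; rewrite mulf_eq0; apply/orP; left; apply: contraT => /ch[E|/ordS_inj E].
  by rewrite E eqxx in ne_S.
by rewrite E eqxx in ne_b.
Qed.

(** Column [c a] is placed at position [r a], and unit vectors fill the positions off the cycle. So
    [\det Q] is the minor of [C] on the cycle, written with all rows as [unimodular] demands. *)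
Definition cycle_cols (i : 'I_g) : 'I_(n + g) :=
  if [pick a | r a == i] is Some a then lshift g (c a) else rshift n i.

Let Q := colsub cycle_cols (row_mx C 1%:M).

Lemma cycle_cols_mul (v : 'I_g -> R) i :
  \sum_k Q i k * v k =
  \sum_a C i (c a) * v (r a) + (if i \in codom r then 0 else v i).
Proof.
have QE k : Q i k = if [pick a | r a == k] is Some a then C i (c a) else (i == k)%:R.
  by rewrite /Q mxE /cycle_cols; case: pickP => [a _|_]; rewrite ?row_mxEl // row_mxEr mxE.
have Qr a : Q i (r a) = C i (c a).
  rewrite QE; case: pickP => [b /eqP/rc_inj-> //|/(_ a)]; by rewrite eqxx.
have Qn k : k \notin codom r -> Q i k = (i == k)%:R.
  move=> kr; rewrite QE; case: pickP => [a /eqP ak|//].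
  by rewrite -ak codom_f in kr.
rewrite (bigID (mem (codom r))) /=; congr (_ + _).
  under [RHS]eq_bigr do rewrite -Qr.
  transitivity (\sum_(k in [set r a | a : 'I_m]%SET) Q i k * v k).
    apply: eq_bigl => k; apply/idP/imsetP => [/codomP[a ->]|[a _ ->]].
      by exists a.
    exact: codom_f.
  rewrite big_imset /=; last by move=> a b _ _; apply: rc_inj.
  by apply: eq_bigl => a; rewrite finset.inE.
have [ir|ir] := boolP (i \in codom r).
  apply: big1 => k kr; rewrite Qn //; case: eqP => [E|]; last by rewrite mul0r.
  by rewrite -E ir in kr.
rewrite (bigD1 i) //= big1 ?addr0 ?Qn ?eqxx ?mul1r // => k /andP[kr ki].
by rewrite Qn // eq_sym (negPf ki) mul0r.
Qed.

(* The determinant is even: [Q] sends [y], which is 1 on the rows of the cycle,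
   to twice an integral vector, because each of these rows of [C] has exactly two
   nonzero entries in the columns of the cycle. *)
Lemma cycle_cols_det0 : \det Q = 0.
Proof.
have C_int i j : C i j \is a Num.int by rewrite signs_int // unimodular_entry.
have Q_int i j : Q i j \is a Num.int.
  rewrite /Q mxE; case: (split_ordP (cycle_cols j)) => k ->.
    by rewrite row_mxEl.
  by rewrite row_mxEr mxE natr_int.
(* Off the cycle, [y] is chosen so that the corresponding entry of [Q y] is 0. *)
pose y k := if k \in codom r then 1 else - \sum_a C k (c a).
have even_row i : (\sum_k Q i k * y k) / 2 \is a Num.int.
  rewrite cycle_cols_mul.
  have -> : \sum_a C i (c a) * y (r a) = \sum_a C i (c a) * 1.
    by apply: eq_bigr => a _; rewrite /y codom_f.
  have [/codomP[a ->]|ir] := ifPn; last first.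
    rewrite /y (negPf ir); under eq_bigr do rewrite mulr1.
    by rewrite subrr mul0r rpred0.
  rewrite -(ord_predK a) chordless_row !mulr1 addr0.
  case: rc => _ c1 c2 _; move: (c1 (ordS (ord_pred a))) (c2 (ord_pred a)).
  move: (C _ _) (C _ _)
        (unimodular_entry (r (ordS (ord_pred a))) (c (ordS (ord_pred a))) uC)
        (unimodular_entry (r (ordS (ord_pred a))) (c (ord_pred a)) uC).
  move=> x z; rewrite !inE => /or3P[]/eqP-> /or3P[]/eqP->; rewrite ?eqxx // => _ _.
  - by rewrite (_ : _ / _ = 1) ?rpred1 //; lra.
  - by rewrite subrr mul0r rpred0.
  - by rewrite addNr mul0r rpred0.
  - by rewrite (_ : _ / _ = -1) ?rpredN ?rpred1 //; lra.
apply/eqP; apply: contraT => det_n0.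
have [a0] : exists a : 'I_m, true by exists (Ordinal (ltnW m_gt1)).
(* Apply the integral matrix [\adj Q] to the integral vector [Q y / 2]: the result is [\det Q / 2]
   times [y], and [y] is 1 at [r a0]. *)
have half : \det Q / 2 \is a Num.int.
  have -> : \det Q / 2 = \sum_i (\adj Q) (r a0) i * ((\sum_k Q i k * y k) / 2).
    have /matrixP/(_ (r a0)) adjQ := mul_adj_mx Q.
    have yr : y (r a0) = 1 by rewrite /y codom_f.
    under [RHS]eq_bigr do rewrite mulrA mulr_sumr.
    rewrite -mulr_suml; congr (_ / _); rewrite exchange_big /=.
    transitivity (\sum_k (\adj Q *m Q) (r a0) k * y k).
      under eq_bigr do rewrite adjQ mxE.
      rewrite (bigD1 (r a0)) //= big1 ?addr0 ?eqxx ?yr ?mulr1 // => k.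
      by rewrite eq_sym => /negPf->; rewrite mulr0n mul0r.
    apply: eq_bigr => k _; rewrite mxE mulr_suml.
    by apply: eq_bigr => i _; rewrite mulrA.
  by apply: rpred_sum => i _; rewrite rpredM // adj_int.
(* If [\det Q] were 1 or -1, its half would be a nonzero integer of absolute value below 1. *)
have := norm_intr_ge1 half; rewrite mulf_neq0 ?invr_eq0 ?pnatr_eq0 // => /(_ isT).
have := uC cycle_cols; rewrite -/Q !inE (negPf det_n0) /= => /orP[]/eqP->.
  rewrite ger0_norm; lra.
rewrite ler0_norm; lra.
Qed.

Lemma chordless_prod :
  \prod_a (C (r a) (c a) * C (r (ordS a)) (c a)) = (-1) ^+ m.
Proof.
have /eqP := cycle_cols_det0; rewrite -det_tr => /det0P[x x_n0 xQ].
have ker i : \sum_k Q i k * x 0 k = 0.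
  move/matrixP/(_ 0 i): xQ; rewrite !mxE => xQ; rewrite -[RHS]xQ.
  by apply: eq_bigr => k _; rewrite [Q^T _ _]mxE mulrC.
case: (rc) => _ c1 c2 _.
(* A kernel vector is multiplied by [- C C] from one vertex to the next, and the
   product of these factors around the cycle is 1. *)
pose z a := C (r a) (c a) * x 0 (r a).
have sqC i j : C i j != 0 -> C i j ^+ 2 = 1.
  by apply: sqr_signs; apply: unimodular_entry.
have zS a : z (ordS a) = - (C (r a) (c a) * C (r (ordS a)) (c a)) * z a.
  have := ker (r (ordS a)); rewrite cycle_cols_mul codom_f addr0.
  rewrite (chordless_row (fun a => x 0 (r a))) -/(z _) => /eqP.
  rewrite addr_eq0 => /eqP->; rewrite /z.
  rewrite -[LHS]mulr1 -(sqC _ _ (c1 a)); ring.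
have z2S a : z (ordS a) ^+ 2 = z a ^+ 2.
  by rewrite zS exprMn sqrrN exprMn !sqC // !mul1r.
(* The square of [z] is constant along the cycle. If it were 0, then [x] would vanish on the rows of
   the cycle, and the kernel equations would make it vanish on the other rows too. *)
have z_n0 a : z a != 0.
  apply: contra_neq x_n0 => za0.
  have z0 b : z b = 0.
    by apply/eqP; rewrite -(sqrf_eq0 (z b)) (ordS_invariant z2S b a) za0 expr0n.
  have xr b : x 0 (r b) = 0.
    by have /eqP := z0 b; rewrite /z mulf_eq0 (negPf (c1 b)) => /eqP.
  apply/rowP => k; rewrite [RHS]mxE; have := ker k; rewrite cycle_cols_mul.
  rewrite big1 => [|b _]; last by rewrite xr mulr0.
  by rewrite add0r; case: ifPn => // /codomP[b ->].
have : \prod_a z (ordS a) = \prod_a z a.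
  by rewrite [RHS](reindex (@ordS m)) //; apply: onW_bij; apply: ordS_bij.
under eq_bigr do rewrite zS.
rewrite big_split prodrN card_ord /= -[RHS]mul1r => /mulIf h.
have := h (introT (prodf_neq0 _ _) (fun a _ => z_n0 a)).
move/(congr1 ( *%R ((-1) ^+ m))); rewrite mulrA mulr1 -expr2 -exprM mulnC exprM.
by rewrite sqrrN expr1n expr1n mul1r.
Qed.

End ChordlessProduct.

End Unimodular.

(** * Bases and tableaux *)

Section FreeFamilies.
Variables (K : fieldType).

(** Greedy extension: [t] collects the elements of [s] that are not in the span reached so far. *)
Lemma free_extend (vT : vectType K) (I : eqType) (f : I -> vT) (s X : seq I) :
  free (map f X) -> exists t : seq I, free (map f (X ++ t)) /\
    (<<map f (X ++ s)>> <= <<map f (X ++ t)>>)%VS.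
Proof.
elim: s X => [|y s IH] X fX; first by exists [::]; rewrite cats0.
have [yX|yX] := boolP (f y \in <<map f X>>%VS).
  have [t [ft sub]] := IH X fX; exists t; split=> //; apply: subv_trans sub.
  rewrite !map_cat !span_cat /= span_cons subv_add addvSl /=.
  by rewrite subv_add addvSr andbT -memvE (subvP (addvSl _ _)).
have fXy : free (map f (rcons X y)).
  by rewrite map_rcons (perm_free (permEl (perm_rcons _ _))) free_cons yX.
by have [t] := IH _ fXy; rewrite !cat_rcons => ft; exists (y :: t).
Qed.

Lemma free_cols g (M : 'M[K]_g) :
  free [seq col i M | i <- enum 'I_g] = (\det M != 0).
Proof.
have entry (k : 'I_g -> K) : (\sum_i k i *: [tuple col i M | i < g]`_i = 0) <->
    ((\row_i k i) *m M^T = 0).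
  have sumE j : (\sum_i k i *: [tuple col i M | i < g]`_i) j 0 =
      ((\row_i k i) *m M^T) 0 j.
    rewrite summxE mxE; apply: eq_bigr => i _.
    by rewrite -tnth_nth tnth_mktuple !mxE.
  split=> h; apply/matrixP => i j; rewrite ord1.
    by rewrite -sumE h !mxE.
  by rewrite sumE h !mxE.
rewrite -det_tr -[map _ _]/(tval [tuple col i M | i < g]).
apply/freeP/idP => [fM|detM k /entry kM i].
  apply/negP => /det0P[v v_n0 vM]; case/eqP: v_n0; apply/rowP => i; rewrite mxE.
  apply: (fM (fun i => v 0 i)); apply/entry; rewrite -[RHS]vM; congr (_ *m _).
  by apply/rowP => j; rewrite mxE.
apply/eqP; apply: contraNT detM => ki; apply/det0P; exists (\row_i k i) => //.
by apply: contraNneq ki => /rowP/(_ i); rewrite !mxE => ->.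
Qed.

Lemma free_full g (s : seq 'cV[K]_g) : free s -> <<s>>%VS = fullv -> size s = g.
Proof.
by rewrite /free => /eqP <- ->; rewrite dimvf dim_matrix mulr1.
Qed.

Lemma full_free g (s : seq 'cV[K]_g) : size s = g -> <<s>>%VS = fullv -> free s.
Proof.
by rewrite /free => -> ->; rewrite dimvf dim_matrix mulr1.
Qed.

End FreeFamilies.

(** * Completed bases and their exchanges *)

Section BasisMatrix.
Variable R : realType.
Variables (g n : nat) (A : 'M[R]_(g, n)).

Let U := row_mx A 1%:M.

Definition spanning_cols (b : seq 'I_n) : Prop :=
  free [seq col i A | i <- b] /\ forall j, col j A \in <<[seq col i A | i <- b]>>%VS.

Lemma spanning_cols_exists : exists b, spanning_cols b.
Proof.
have [b [fb sub]] := @free_extend R _ _ (fun i => col i A) (enum 'I_n) [::] (nil_free _).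
exists b; split=> // j; apply: (subvP sub); apply: memv_span; apply: map_f.
by rewrite mem_enum.
Qed.

Lemma map_col_lshift (b : seq 'I_n) :
  [seq col k U | k <- map (@lshift n g) b] = [seq col i A | i <- b].
Proof. by rewrite -map_comp; apply: eq_map => i; rewrite /= colKl. Qed.

(** The rank of [A] may be less than [g], so a basis of its column space is completed to one of the
    whole space by further columns of [U]. *)
Definition completes (b : seq 'I_n) (t : seq 'I_(n + g)) : Prop :=
  (size b + size t)%N = g /\ <<map (fun k => col k U) (map (@lshift n g) b ++ t)>>%VS = fullv.

Lemma completion_exists b : free [seq col i A | i <- b] -> exists t, completes b t.
Proof.
rewrite -map_col_lshift => fb.
have [t [ft sub]] := free_extend (map (@rshift n g) (enum 'I_g)) fb.
exists t; have full : <<map (fun k => col k U) (map (@lshift n g) b ++ t)>>%VS = fullv.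
  apply/eqP; rewrite eqEsubv subvf; apply: subv_trans sub.
  apply/subvP => v _.
  have -> : v = \sum_i v i 0 *: col (rshift n i) U.
    apply/colP => i; rewrite summxE (bigD1 i) //= big1 => [|k ki].
      by rewrite colKr !mxE eqxx mulr1 addr0.
    by rewrite colKr !mxE eq_sym (negPf ki) mulr0.
  apply: memv_suml => i _; apply/memvZ/memv_span/map_f.
  by rewrite mem_cat map_f ?orbT // mem_enum.
by split=> //; have := free_full ft full; rewrite size_map size_cat size_map.
Qed.

Section Completed.
Variables (b : seq 'I_n) (t : seq 'I_(n + g)).
Hypotheses (b_span : spanning_cols b) (bt : completes b t).

(** By dimension, an independent [l] of this size spans the same space as [b], so [t] completes it
    as well. *)
Lemma free_completed (l : seq 'I_n) : size l = size b ->
  free [seq col k U | k <- map (@lshift n g) l ++ t] = free [seq col i A | i <- l].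
Proof.
move=> szl; rewrite map_cat map_col_lshift; apply/idP/idP => [/catl_free //|fl].
have [fb b_all] := b_span; have [sz full] := bt.
apply: full_free; first by rewrite size_cat !size_map szl.
rewrite -[RHS]full map_cat map_col_lshift !span_cat; congr (_ + _)%VS.
apply/eqP; rewrite eqEdim; apply/andP; split.
  by apply/span_subvP => _ /mapP[i _ ->].
by move: fl fb => /eqP-> /eqP->; rewrite !size_map szl.
Qed.

Definition basis_idx (k0 : 'I_(n + g)) (i : 'I_g) : 'I_(n + g) :=
  nth k0 (map (@lshift n g) b ++ t) i.

Variable k0 : 'I_(n + g).
Notation bidx := (basis_idx k0).

Lemma map_basis_idx : map bidx (enum 'I_g) = map (@lshift n g) b ++ t.
Proof.
apply: (@eq_from_nth _ k0) => [|i].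
  by rewrite size_map size_enum_ord size_cat size_map; case: bt.
rewrite size_map size_enum_ord => lt_i.
by rewrite (nth_map (Ordinal lt_i)) ?size_enum_ord // /basis_idx nth_enum_ord.
Qed.

Lemma basis_idx_det : \det (colsub bidx U) != 0.
Proof.
rewrite -free_cols.
have -> : [seq col i (colsub bidx U) | i <- enum 'I_g] =
    [seq col k U | k <- map (@lshift n g) b ++ t].
  rewrite -map_basis_idx -map_comp; apply: eq_map => i.
  by apply/colP => k; rewrite !mxE.
by rewrite free_completed //; case: b_span.
Qed.

(** At a position of [b] the exchange leaves [t] untouched, so the column matroid alone decides the
    outcome. *)
Lemma subst_lt (i : 'I_g) j : (i < size b)%N ->
  (\det (colsub (subst_at bidx i (lshift g j)) U) != 0) =
  free [seq col k A | k <- set_nth j b i j].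
Proof.
move=> lt_i; rewrite -free_cols -free_completed; last by rewrite size_set_nth; lia.
congr free; rewrite map_cat.
apply: (@eq_from_nth _ 0) => [|k].
  rewrite size_map size_enum_ord size_cat !size_map size_set_nth.
  by case: bt => sz _; lia.
rewrite size_map size_enum_ord => lt_k.
rewrite (nth_map (Ordinal lt_k)) ?size_enum_ord // -map_cat.
have szk : (k < size (map (@lshift n g) (set_nth j b i j) ++ t))%N.
  by rewrite size_cat size_map size_set_nth; case: bt => sz _; lia.
rewrite (nth_map k0) //.
transitivity (col (subst_at bidx i (lshift g j) (Ordinal lt_k)) U).
  rewrite (_ : nth _ _ _ = Ordinal lt_k).
    by apply/colP => l; rewrite !mxE.
  by apply: val_inj; rewrite /= nth_enum_ord.
congr col; rewrite /subst_at /basis_idx -val_eqE /= !nth_cat !size_map size_set_nth.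
have -> : maxn i.+1 (size b) = size b by lia.
case: ltnP => [lt_kb|le_bk]; last by case: eqP => // E; lia.
rewrite !(nth_map j) ?size_set_nth ?nth_set_nth //=; last by lia.
by case: eqP.
Qed.

(** At a position of [t] the exchange keeps all of [b], whose span already contains column [j]. *)
Lemma subst_ge (i : 'I_g) j : (size b <= i)%N ->
  \det (colsub (subst_at bidx i (lshift g j)) U) = 0.
Proof.
move=> le_i; apply/eqP; apply: contraT; rewrite -free_cols => fF.
pose f := subst_at bidx i (lshift g j).
have mapE : [seq col k (colsub f U) | k <- enum 'I_g] =
    [seq col k U | k <- map f (enum 'I_g)].
  by rewrite -map_comp; apply: eq_map => k; apply/colP => l; rewrite !mxE.
rewrite mapE in fF.
have f_uniq : uniq (map f (enum 'I_g)) := map_uniq (free_uniq fF).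
have jF : lshift g j \in map f (enum 'I_g).
  by apply/mapP; exists i; rewrite ?mem_enum // /f /subst_at eqxx.
move: fF; rewrite (perm_free (perm_map _ (perm_to_rem jF))) /= free_cons => /andP[+ _].
case/negP; rewrite colKl; have [_ /(_ j)] := b_span; apply: subvP.
apply/span_subvP => _ /mapP[k kb ->]; rewrite -[X in X \in _](colKl k A 1%:M).
apply/memv_span/map_f; rewrite mem_rem_uniq // inE.
pose a := index k b; have lt_a : (a < size b)%N by rewrite index_mem.
have lt_ag : (a < g)%N by case: bt => sz _; lia.
have fa : f (Ordinal lt_ag) = lshift g k.
  rewrite /f /subst_at -val_eqE /=; case: eqP => [E|_]; first by lia.
  by rewrite /basis_idx nth_cat size_map lt_a (nth_map k) // nth_index.
apply/andP; split; last by rewrite -fa map_f ?mem_enum.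
rewrite -fa -[lshift g j](_ : f i = _); last by rewrite /f /subst_at eqxx.
have /injectiveP f_inj : injectiveb f by [].
by rewrite (inj_eq f_inj) -val_eqE /=; apply/eqP; lia.
Qed.

End Completed.

Lemma pivot_mul (P : 'M[R]_g) : P \in unitmx ->
  P *m row_mx (invmx P *m A) 1%:M = row_mx A P.
Proof. by move=> uP; rewrite mul_mx_row mulKVmx // mulmx1. Qed.

(* With [P = colsub f U], the columns of [row_mx A P] are again columns of [U]. *)
Lemma pivot_unimodular (f : 'I_g -> 'I_(n + g)) :
  totally_unimodular A -> \det (colsub f U) != 0 ->
  unimodular (row_mx (invmx (colsub f U) *m A) 1%:M).
Proof.
move=> /tu_unimodular uU; set P := colsub f U => detP h.
have uP : P \in unitmx by rewrite unitmxE unitfE.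
have := uU (fun k => match split (h k) with inl i => lshift g i | inr i => f i end).
set Q := colsub _ U; have -> : Q = P *m colsub h (row_mx (invmx P *m A) 1%:M).
  rewrite mulmx_colsub pivot_mul //; apply/matrixP => i k; rewrite [LHS]mxE [RHS]mxE.
  case: (split_ordP (h k)) => l ->; first by rewrite !row_mxEl.
  by rewrite row_mxEr [RHS]mxE.
rewrite det_mulmx => PQ; have := sqr_signs (uU f) detP.
rewrite -/P expr2 => P2; set d := \det (colsub h _) in PQ *.
rewrite (_ : d = \det P * (\det P * d)); last by rewrite mulrA P2 mul1r.
exact: signsM (uU f) PQ.
Qed.

(** Multiplication by the basis matrix turns the exchange of [det_subst_id] into an exchange in the
    basis, at the cost of a nonzero factor. *)
Lemma pivot_entry (f : 'I_g -> 'I_(n + g)) i j : \det (colsub f U) != 0 ->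
  ((invmx (colsub f U) *m A) i j != 0) =
  (\det (colsub (subst_at f i (lshift g j)) U) != 0).
Proof.
set P := colsub f U => detP.
have uP : P \in unitmx by rewrite unitmxE unitfE.
rewrite -det_subst_id.
have -> : colsub (subst_at f i (lshift g j)) U =
    P *m colsub (subst_at (@rshift n g) i (lshift g j)) (row_mx (invmx P *m A) 1%:M).
  rewrite mulmx_colsub pivot_mul //; apply/matrixP => a k; rewrite mxE [RHS]mxE /subst_at.
  case: (k == i); first by rewrite !row_mxEl.
  by rewrite row_mxEr [RHS]mxE.
by rewrite det_mulmx mulf_eq0 (negPf detP).
Qed.

End BasisMatrix.

(** * Unique representability *)

Section UniqueRepresentation.
Variable R : realType.

Lemma unimodular_sign_scaling g n (C C' : 'M[R]_(g, n)) :
    unimodular (row_mx C 1%:M) -> unimodular (row_mx C' 1%:M) ->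
    (forall i j, (C i j != 0) = (C' i j != 0)) ->
  exists (d : 'I_g -> R) (e : 'I_n -> R),
    [/\ forall i, d i ^+ 2 = 1, forall j, e j ^+ 2 = 1
      & forall i j, d i * C i j = C' i j * e j].
Proof.
move=> uC uC' supp; pose w i j := C i j * C' i j.
have w_n0 i j : (w i j != 0) = (C i j != 0) by rewrite mulf_eq0 negb_or -supp andbb.
have sqC i j : C i j != 0 -> C i j ^+ 2 = 1.
  by apply: sqr_signs; apply: unimodular_entry.
have sqC' i j : C i j != 0 -> C' i j ^+ 2 = 1.
  by rewrite supp; apply: sqr_signs; apply: unimodular_entry.
have w2 i j : w i j != 0 -> w i j ^+ 2 = 1.
  by rewrite w_n0 => h; rewrite exprMn sqC // sqC' // mulr1.
have [|d [e [d2 e2 wde]]] := sign_potential w2.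
  move=> m r c m_gt1 [r_inj w1 wS wch].
  have chC : chordless C r c.
    by split=> // *; [rewrite -w_n0|rewrite -w_n0|apply: wch; rewrite w_n0].
  have chC' : chordless C' r c.
    by split=> // *; [rewrite -supp -w_n0|rewrite -supp -w_n0|apply: wch; rewrite w_n0 supp].
  (* The cycle is chordless for both tableaux, so each contributes the same sign and the product is
     its square. *)
  under eq_bigr do rewrite /w mulrACA.
  by rewrite big_split /= !chordless_prod // -expr2 sqrr_sign.
exists d, e; split=> // i j; have [Cij|Cij] := eqVneq (C i j) 0.
  by have := supp i j; rewrite Cij eqxx => /esym/negbFE/eqP->; rewrite mulr0 mul0r.
have wij : w i j != 0 by rewrite w_n0.
have := wde i j wij; rewrite /w => h.
have := sqC' i j Cij; have := d2 i; have := e2 j; rewrite !expr2 => he hd hC.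
rewrite -[LHS]mulr1 -[in LHS]hC (_ : _ * _ = d i * (C i j * C' i j) * C' i j); last by ring.
by rewrite h mulrA hd mul1r mulrC.
Qed.

Lemma int_unit_matrix g (F : 'M[R]_g) :
    (forall i j, F i j \is a Num.int) -> \det F ^+ 2 = 1 ->
  exists2 X : 'M[int]_g, X \in unitmx & map_mx intr X = F.
Proof.
move=> F_int F2; have XF : map_mx intr (map_mx Num.floor F) = F :> 'M[R]_g.
  by apply/matrixP => i j; rewrite !mxE floorK.
exists (map_mx Num.floor F) => //; rewrite unitmxE.
move: F2; rewrite -{1}XF det_map_mx -rmorphXn /= -[RHS](@rmorph1 _ _ intr).
by move/intr_inj => h; apply/unitrPr; exists (\det (map_mx Num.floor F)); rewrite -expr2.
Qed.

Theorem tu_unique_representation g n (A A' : 'M[R]_(g, n)) :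
    totally_unimodular A -> totally_unimodular A' ->
    (forall l : seq 'I_n, free [seq col i A | i <- l] = free [seq col i A' | i <- l]) ->
  exists (X : 'M[int]_g) (e : 'rV[R]_n),
    [/\ X \in unitmx, forall j, e 0 j ^+ 2 = 1
      & map_mx intr X *m A = A' *m diag_mx e].
Proof.
(* The index [k0] below needs a row; without rows the equation is between empty matrices. *)
case: g A A' => [|g] A A' tuA tuA' indepE.
  exists 1%:M, (const_mx 1); split; first exact: unitmx1.
    by move=> j; rewrite mxE expr1n.
  by apply/matrixP => -[].
have [b b_span] := spanning_cols_exists A.
(* For independent [b], column [j] lies in its span exactly when [j :: b] is dependent, on which the
   two matrices agree. *)
have b_span' : spanning_cols A' b.
  have [fb b_all] := b_span; split=> [|j]; first by rewrite -indepE.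
  have := indepE (j :: b); rewrite /= !free_cons b_all -indepE fb !andbT /=.
  by move/esym/negbFE.
have [t bt] := completion_exists b_span.1.
have [t' bt'] := completion_exists b_span'.1.
pose k0 := rshift n (@ord0 g).
pose f := basis_idx b t k0; pose f' := basis_idx b t' k0.
have detP := basis_idx_det b_span bt k0; have detP' := basis_idx_det b_span' bt' k0.
rewrite -/f in detP; rewrite -/f' in detP'.
have uC := pivot_unimodular tuA detP; have uC' := pivot_unimodular tuA' detP'.
have supp i j : ((invmx (colsub f (row_mx A 1%:M)) *m A) i j != 0) =
                ((invmx (colsub f' (row_mx A' 1%:M)) *m A') i j != 0).
  rewrite !pivot_entry //; have [lt_i|le_i] := ltnP i (size b).
    by rewrite (subst_lt b_span bt) // (subst_lt b_span' bt').
  by rewrite (subst_ge b_span bt) // (subst_ge b_span' bt') // eqxx.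
have [d [e [d2 e2 de]]] := unimodular_sign_scaling uC uC' supp.
move: (tu_unimodular tuA f) (tu_unimodular tuA' f') => sP sP'.
have entry_int (B : 'M[R]_(g.+1, n)) h i j : totally_unimodular B ->
    colsub h (row_mx B 1%:M) i j \is a Num.int.
  move=> tuB; rewrite mxE; case: (split_ordP (h j)) => k ->.
    by rewrite row_mxEl signs_int // unimodular_entry //; apply: tu_unimodular.
  by rewrite row_mxEr mxE natr_int.
set P := colsub f _ in detP sP uC supp de *.
set P' := colsub f' _ in detP' sP' uC' supp de *.
have P_int i j : P i j \is a Num.int by apply: entry_int.
have P'_int i j : P' i j \is a Num.int by apply: entry_int.
have uP : P \in unitmx by rewrite unitmxE unitfE.
have uP' : P' \in unitmx by rewrite unitmxE unitfE.
pose D : 'rV[R]_g.+1 := \row_i d i.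
have d_int i : d i \is a Num.int.
  have /eqP := d2 i; rewrite sqrf_eq1 => /orP[]/eqP->.
    exact: rpred1.
  by rewrite rpredN rpred1.
have [||X uX XE] := @int_unit_matrix _ (P' *m diag_mx D *m invmx P).
- move=> i j; rewrite mxE; apply: rpred_sum => k _; rewrite mul_mx_diag rpredM //.
    by rewrite mxE rpredM // mxE.
  (* The inverse of [P] is integral because its determinant is 1 or -1. *)
  rewrite /invmx uP mxE rpredM ?adj_int //.
  by move: sP detP; rewrite !inE => /or3P[]/eqP->; rewrite ?eqxx // ?invrN invr1 ?rpredN rpred1.
- rewrite !det_mulmx det_inv det_diag !exprMn exprVn (sqr_signs sP detP).
  rewrite (sqr_signs sP' detP') invr1 mulr1 mul1r.
  by rewrite -prodrXl big1 // => i _; rewrite mxE d2.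
exists X, (\row_j e j); split=> // [j|]; first by rewrite mxE e2.
rewrite XE -!mulmxA -[in RHS](mulKVmx uP' A') -!mulmxA; congr (P' *m _).
apply/matrixP => i j; rewrite mul_diag_mx mulmxA mul_mx_diag.
by rewrite [LHS]mxE [RHS]mxE [D _ _]mxE (mxE _ _ 0 j) de.
Qed.

End UniqueRepresentation.

(** * The action on the rays *)

Section PermConjugation.
Variables (S T : finType) (f : S -> T) (f_bij : bijective f).

(** The isomorphism is conjugation by [f]. Membership is compared for pairs intertwined by [f], so
    that uses need no formula for its inverse. *)
Lemma isog_perm_conj (G : {group {perm S}}) (H : {group {perm T}}) :
    (forall (s : {perm S}) (t : {perm T}),
       (forall x, t (f x) = f (s x)) -> (s \in G) = (t \in H)) ->
  G \isog H.
Proof.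
move=> GH; have [f' fK f'K] := f_bij.
have conj_inj (s : {perm S}) : injective (fun y => f (s (f' y))).
  by move=> y z /(can_inj fK)/perm_inj/(can_inj f'K).
pose c s : {perm T} := perm (@conj_inj s).
have cE s x : c s (f x) = f (s x) by rewrite permE fK.
have cM : {in G &, {morph c : s t / (s * t)%g}}.
  move=> s t _ _; apply/permP => y; rewrite -(f'K y).
  by rewrite cE !permM !cE.
apply/isogP; exists (Morphism cM); last first.
  apply/setP => t; apply/morphimP/idP => [[s _ sG ->]|tH] /=.
    by rewrite -(GH s) // => x; rewrite cE.
  have conj'_inj : injective (fun x => f' (t (f x))).
    by move=> x z /(can_inj f'K)/perm_inj/(can_inj fK).
  have st x : t (f x) = f (perm conj'_inj x) by rewrite permE f'K.
  have sG : perm conj'_inj \in G by rewrite (GH _ t).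
  exists (perm conj'_inj) => //; apply/permP => y; rewrite -(f'K y).
  by rewrite /= cE -st.
apply/injmP => s t _ _ /= /permP cst; apply/permP => x.
by apply: (can_inj fK); rewrite -!cE cst.
Qed.

End PermConjugation.

Lemma matroid_iso_Aut (E F : finType) (M : matroid E) (N : matroid F) :
  matroid_iso M N -> matroid_Aut_group M \isog matroid_Aut_group N.
Proof.
case=> f f_bij fP; apply: (isog_perm_conj f_bij) => s t st.
have img (S : {set E}) : (t @: (f @: S) = f @: (s @: S))%SET.
  by rewrite -!imset_comp; apply: eq_imset => x /=; rewrite st.
have [f' fK f'K] := f_bij.
apply/matroid_AutP/matroid_AutP => h S; last by rewrite -fP -img h fP.
have -> : S = (f @: (f' @: S))%SET.
  by rewrite -imset_comp (eq_imset (g := id)) ?imset_id.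
by rewrite img !fP h.
Qed.

Section ColumnFamilies.
Variables (K : fieldType).

Lemma free_injective (vT wT : vectType K) (f : 'Hom(vT, wT)) (X : seq vT) :
  lker f = 0%VS -> free (map f X) = free X.
Proof.
by move=> f0; rewrite /free -limg_span size_map limg_dim_eq // f0 capv0.
Qed.

Lemma free_scale (vT : vectType K) (I : eqType) (v : I -> vT) (c : I -> K) (l : seq I) :
  (forall i, c i != 0) -> free [seq c i *: v i | i <- l] = free [seq v i | i <- l].
Proof.
move=> c0; rewrite /free !size_map; congr (\dim _ == _); apply/eqP.
rewrite eqEsubv; apply/andP; split; apply/span_subvP => _ /mapP[i il ->].
  by apply/memvZ/memv_span/map_f.
rewrite -[v i]scale1r -(mulVf (c0 i)) -scalerA.
by apply/memvZ/memv_span/(map_f (fun i => c i *: v i)).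
Qed.

Lemma free_cols_transform g n (A A' : 'M[K]_(g, n)) (G : 'M[K]_g) (c : 'I_n -> K) :
    G \in unitmx -> (forall i, c i != 0) ->
    (forall i, G *m col i A = c i *: col i A') ->
  forall l : seq 'I_n, free [seq col i A | i <- l] = free [seq col i A' | i <- l].
Proof.
move=> uG c0 GA l; rewrite -(free_scale (fun i => col i A') l c0).
pose f : 'Hom('cV[K]_g, 'cV[K]_g) := linfun (mulmx G).
have f0 : lker f = 0%VS.
  apply/eqP; rewrite -subv0; apply/subvP => v; rewrite memv_ker memv0 lfunE /= => /eqP Gv.
  by rewrite -(mulKmx uG v) Gv mulmx0.
rewrite -(free_injective _ f0) -map_comp; congr free; apply: eq_map => i.
by rewrite /= lfunE /= GA.
Qed.

Lemma columns_indep_seq g n (A : 'M[K]_(g, n)) (l : seq 'I_n) : uniq l ->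
  ([set i in l]%SET \in columns_indep A) = free [seq col i A | i <- l].
Proof.
move=> l_uniq; apply: columns_indepE; apply: uniq_perm; rewrite ?enum_uniq //.
by move=> i; rewrite mem_enum finset.inE.
Qed.

(** Sequences may replace sets because a repeated index makes both families dependent. *)
Lemma column_matroid_AutP g n (A : 'M[K]_(g, n)) (s : {perm 'I_n}) :
  s \in matroid_Aut (column_matroid A) <->
  forall l : seq 'I_n,
    free [seq col i A | i <- l] = free [seq col i (col_perm s A) | i <- l].
Proof.
have colE l : [seq col i (col_perm s A) | i <- l] = [seq col i A | i <- map s l].
  by rewrite -map_comp; apply: eq_map => i; apply/colP => k; rewrite !mxE.
have imE l : (s @: [set i in l] = [set i in map s l])%SET.
  apply/setP => i; rewrite finset.inE; apply/imsetP/mapP.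
    by case=> j; rewrite finset.inE; exists j.
  by case=> j jl ->; exists j; rewrite ?finset.inE.
split=> [/matroid_AutP h l|h]; last first.
  apply/matroid_AutP => S; rewrite -(finset.set_enum S) imE /=.
  rewrite !columns_indep_seq ?(map_inj_uniq perm_inj) ?enum_uniq //.
  by rewrite -colE h.
rewrite colE; have [l_uniq|l_nuniq] := boolP (uniq l).
  rewrite -!columns_indep_seq ?(map_inj_uniq perm_inj) //.
  by rewrite -imE -[RHS]/(_ \in indep (column_matroid A)) h.
transitivity false; last apply/esym; apply: contraNF l_nuniq => /free_uniq/map_uniq //.
by rewrite (map_inj_uniq perm_inj).
Qed.

End ColumnFamilies.

(** * Rays, congruences and matroid automorphisms *)

Section Rays.
Variables (R : realType) (g n : nat) (A : 'M[R]_(g, n)).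

(** Compare the two matrices in a row [a] with [u a 0] nonzero: this row of the left side is a
    nonzero multiple of [u], that of the right side a multiple of [v]. *)
Lemma rank_one_parallel (u v : 'cV[R]_g) t :
  u != 0 -> u *m u^T = t *: (v *m v^T) -> exists c, u = c *: v.
Proof.
move=> u0 uv; have entry a b : u a 0 * u b 0 = t * (v a 0 * v b 0).
  by move/matrixP/(_ a b): uv; rewrite !mxE !big_ord1 !mxE.
have [a ua] : exists a, u a 0 != 0.
  apply/existsP; apply: contraT => /existsPn h; case/eqP: u0.
  by apply/colP => a; rewrite mxE; apply/eqP/negPn/h.
exists (t * v a 0 / u a 0); apply/colP => b; rewrite !mxE.
by rewrite -[LHS](mulKf ua) entry; field.
Qed.

Lemma simple_columns : simple_matroid (column_matroid A) ->
  (forall i, col i A != 0) /\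
  (forall i j, i != j -> free [:: col i A; col j A]).
Proof.
case=> loops par; have set1E i : [set i]%SET = [set k in [:: i]]%SET.
  by apply/setP => k; rewrite !finset.inE.
have set2E i j : [set i; j]%SET = [set k in [:: i; j]]%SET.
  by apply/setP => k; rewrite !finset.inE.
split=> [i|i j ij].
  have := loops i; rewrite negbK set1E /= columns_indep_seq //=.
  by rewrite seq1_free.
have := par i j; rewrite /matroid_parallel ij !loops /= negbK set2E.
by rewrite columns_indep_seq //= inE ij.
Qed.

Hypothesis A_simple : simple_matroid (column_matroid A).

Lemma rank_one_ray i : ray A i (rank_one A i).
Proof. by exists 1; rewrite ?ler01 ?scale1r. Qed.

(** Equal rays would make two columns proportional, which simplicity excludes. *)
Lemma ray_inj : injective (ray A).
Proof.
have [col0 col2] := simple_columns A_simple.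
move=> i j rij; have := rank_one_ray i; rewrite rij => -[t _ /rank_one_parallel].
move=> /(_ (col0 i))[c ci]; apply/eqP; apply: contraT => /col2.
rewrite free_cons span_seq1 => /andP[/negP[]].
by rewrite ci memvZ // memv_line.
Qed.

Lemma ray_in_rays i : ray A i \in rays A.
Proof. by apply/imfsetP; exists i. Qed.

Definition ray_idx i : rays A := [` ray_in_rays i]%fset.

Lemma ray_idx_bij : bijective ray_idx.
Proof.
have inj : injective ray_idx by move=> i j /(congr1 val)/= /ray_inj.
have surj (r : rays A) : exists i, ray_idx i == r.
  have /imfsetP[i _ ri] := valP r; exists i; apply/eqP/val_inj; exact/esym.
exists (fun r => xchoose (surj r)) => [i|r]; last exact/eqP/(xchooseP (surj r)).
by apply: inj; apply/eqP/(xchooseP (surj _)).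
Qed.

Lemma congr_act_rank_one X i :
  congr_act X (rank_one A i) =
  ((map_mx intr X)^T *m col i A) *m ((map_mx intr X)^T *m col i A)^T.
Proof. by rewrite /congr_act /rank_one trmx_mul trmxK !mulmxA. Qed.

Lemma congr_actZ X t (Q : 'M[R]_g) : congr_act X (t *: Q) = t *: congr_act X Q.
Proof. by rewrite /congr_act -scalemxAr -scalemxAl. Qed.

Lemma congr_act_sum X (c : 'I_n -> R) (Q : 'I_n -> 'M[R]_g) :
  congr_act X (\sum_i c i *: Q i) = \sum_i c i *: congr_act X (Q i).
Proof.
rewrite {1}/congr_act mulmx_sumr mulmx_suml; apply: eq_bigr => i _.
by rewrite -congr_actZ.
Qed.

Lemma congr_act_ray X (s : {perm 'I_n}) :
    (forall i, congr_act X (rank_one A i) = rank_one A (s i)) ->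
  forall i, (congr_act X @` ray A i = ray A (s i))%classic.
Proof.
move=> sX i; apply/seteqP; split=> [_ [_ [t t0 ->] <-]|_ [t t0 ->]].
  by exists t; rewrite // congr_actZ sX.
by exists (t *: rank_one A i); [exists t|rewrite congr_actZ sX].
Qed.

Lemma congr_act_cone X (s : {perm 'I_n}) :
    (forall i, congr_act X (rank_one A i) = rank_one A (s i)) ->
  (congr_act X @` cone A = cone A)%classic.
Proof.
move=> sX; apply/seteqP; split=> [_ [_ [c c0 ->] <-]|_ [c c0 ->]].
  exists (fun i => c ((s^-1)%g i)) => //; rewrite congr_act_sum.
  rewrite [RHS](reindex_inj (@perm_inj _ s)); apply: eq_bigr => i _.
  by rewrite permK sX.
exists (\sum_i c (s i) *: rank_one A i); first by exists (fun i => c (s i)).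
rewrite congr_act_sum [RHS](reindex_inj (@perm_inj _ s)).
by apply: eq_bigr => i _; rewrite sX.
Qed.

Lemma Aut_ray_perms : totally_unimodular A ->
  matroid_Aut_group (column_matroid A) \isog ray_perms_group A.
Proof.
move=> tuA; have [col0 _] := simple_columns A_simple.
apply: (isog_perm_conj ray_idx_bij) => s t st.
have colE i : col i (col_perm s A) = col (s i) A by apply/colP => k; rewrite !mxE.
have val_t i : val (t (ray_idx i)) = ray A (s i) by rewrite st.
apply/idP/ray_permsP => [/column_matroid_AutP sA|[X [uX _] Xt]].
  have tuA' : totally_unimodular (col_perm s A).
    move=> k r c _ _; rewrite (_ : mxsub _ _ _ = mxsub r (s \o c) A) ?tu_minor //.
    by apply/matrixP => i j; rewrite !mxE.
  have [X [e [uX e2 XA]]] := tu_unique_representation tuA tuA' sA.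
  (* Congruence acts on columns by the transpose, hence [X^T]. The signs [e] cancel in the rank one
     matrices. *)
  have Xs i : congr_act X^T (rank_one A i) = rank_one A (s i).
    have Xi : map_mx intr X *m col i A = e 0 i *: col (s i) A.
      rewrite -colE; apply/colP => k; move/matrixP/(_ k i): XA.
      rewrite mul_mx_diag [X in _ = X]mxE => XAki.
      rewrite [RHS]mxE [X in _ = _ * X]mxE mulrC -XAki ![LHS]mxE [RHS]mxE.
      by apply: eq_bigr => l _; rewrite [col _ _ _ _]mxE.
    rewrite congr_act_rank_one -map_trmx trmxK Xi linearZ /= -scalemxAl -scalemxAr.
    by rewrite scalerA -expr2 e2 scale1r.
  exists X^T; first by split; [rewrite unitmx_tr|apply: (congr_act_cone Xs)].
  move=> r; have [f' _ f'K] := ray_idx_bij; rewrite -(f'K r) val_t.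
  by rewrite (congr_act_ray Xs).
apply/column_matroid_AutP.
have uXR : (map_mx (intr : int -> R) X)^T \in unitmx.
  rewrite unitmx_tr unitmxE det_map_mx rmorph_unit //.
(* A congruence that permutes the rays determines the image of each column up to a factor, which is
   nonzero since [X] is invertible. *)
have Xs i : exists c : R, (map_mx intr X)^T *m col i A = c *: col i (col_perm s A).
  have := Xt (ray_idx i); rewrite val_t /= => rE.
  have : ray A (s i) (congr_act X (rank_one A i)).
    by rewrite rE; exists (rank_one A i) => //; apply: rank_one_ray.
  case=> q _; rewrite congr_act_rank_one colE => /rank_one_parallel; apply.
  by apply: contraNneq (col0 i) => Xi; rewrite -(mulKmx uXR (col i A)) Xi mulmx0.
have [c cE] := fin_all_exists Xs.
apply: (free_cols_transform uXR (c := c)) => // i.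
apply: contraNneq (col0 i) => ci.
by rewrite -(mulKmx uXR (col i A)) cE ci scale0r mulmx0.
Qed.

End Rays.

Lemma simple_matroid_iso (E F : finType) (M : matroid E) (N : matroid F) :
  matroid_iso M N -> simple_matroid N -> simple_matroid M.
Proof.
case=> f f_bij fP [loops par].
have loopE e : matroid_loop M e = matroid_loop N (f e).
  by rewrite /matroid_loop -fP imset_set1.
split=> [e|e1 e2]; first by rewrite loopE.
have := par (f e1) (f e2); rewrite /matroid_parallel -!loopE (bij_eq f_bij).
by rewrite -(fP [set e1; e2]%SET) imsetU !imset_set1.
Qed.

Theorem theorem5p10 (R : realType) (E : finType) (M : matroid E)
    (g n : nat) (A : 'M[R]_(g, n)) :
  simple_matroid M ->
  regular_matroid R M ->
  totally_unimodular A ->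
  matroid_iso (column_matroid A) M ->
  isog (ray_perms_group A) (matroid_Aut_group M).
Proof.
move=> simM _ tuA isoM; apply: isog_trans (matroid_iso_Aut isoM).
by rewrite isog_sym; apply: Aut_ray_perms tuA; apply: simple_matroid_iso isoM simM.
Qed.
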